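(* Let $f:S^1\to\mathbb{R}$ be upper semicontinuous, $\lambda\ge0$, and let $\mu_1=\sum_{j=1}^N r_j\delta_{x_j}\in\mathcal{M}_+(S^1)$ be a finitely supported measure with exactly $N$ atoms. Then the problem \[ \sup_{\mu_0\in\mathcal{B}_\lambda(\mu_1)}\int_{S^1}f\,\mathrm{d}\mu_0 \] admits a maximizer $\mu_0$ that is a finitely supported nonnegative measure with at most $N+2$ support points.
   Context: $S^1$ is the unit circle in $\mathbb{C}$. $\mathcal{B}_\lambda(\mu_1):=\{\mu_0\in\mathcal{M}_+(S^1):\mathcal{U}(\mu_0,\mu_1)\le\lambda\}$, where $\mathcal{U}$ is the Wasserstein–Fisher–Rao distance: for $\mu_0,\mu_1\in\mathcal{M}_+(S^1)$, let $\Gamma(\mu_0,\mu_1)$ be the set of nonnegative Borel measures $\gamma$ on $\mathbb{C}\times\mathbb{C}$ with finite second moment such that $(\theta_i)_\#(r_i^2\gamma)=\mu_i$, $i=0,1$, with $r_i(x_0,x_1)=|x_i|$, $\theta_i(x_0,x_1)=x_i/|x_i|$ (a fixed arbitrary point of $S^1$ if $x_i=0$); $\mathcal{U}(\mu_0,\mu_1):=\inf_{\gamma\in\Gamma(\mu_0,\mu_1)}(\int|x-y|^2\,\mathrm{d}\gamma)^{1/2}$ ($+\infty$ if $\Gamma=\emptyset$). *)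

(* Defs.v *)
(* S^1 ⊂ C ≅ R × R; measures on S^1 are encoded as
   Borel measures on R × R concentrated on the unit circle. *)
From mathcomp Require Import all_boot all_order all_algebra.
From mathcomp Require Import all_classical all_reals all_analysis.
Set Implicit Arguments. Unset Strict Implicit. Unset Printing Implicit Defensive.
Import Order.TTheory GRing.Theory Num.Theory.
Import numFieldNormedType.Exports.
Local Open Scope ring_scope.
Local Open Scope classical_set_scope.

Section WFR.
Variable R : realType.

Definition sqnorm (p : R * R) : R := p.1 ^+ 2 + p.2 ^+ 2.

Definition sqdist (p q : R * R) : R := (p.1 - q.1) ^+ 2 + (p.2 - q.2) ^+ 2.

Definition circle : set (R * R) := [set p | sqnorm p = 1].

Definition theta (p : R * R) : R * R :=
  if p == (0, 0) then (1, 0)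
  else (p.1 / Num.sqrt (sqnorm p), p.2 / Num.sqrt (sqnorm p)).

(* M_+(S^1): finite nonnegative Borel measures on S^1 (encoded as finite
   Borel measures on R × R giving no mass outside the circle) *)
Definition Mplus (mu : {measure set (R * R)%type -> \bar R}) : Prop :=
  (mu setT < +oo)%E /\ mu (~` circle) = 0%E.

(* γ ∈ Γ(μ0, μ1): nonnegative Borel measure on C × C with finite second
   moment and (θ_i)_# (r_i^2 γ) = μ_i, i = 0, 1 *)
Definition is_plan (mu0 mu1 : {measure set (R * R)%type -> \bar R})
    (g : {measure set ((R * R) * (R * R))%type -> \bar R}) : Prop :=
  (\int[g]_z ((sqnorm z.1 + sqnorm z.2)%:E) < +oo)%E /\
  (forall A : set (R * R), measurable A ->
      mu0 A = (\int[g]_(z in (fun z => theta z.1) @^-1` A) (sqnorm z.1)%:E)%E) /\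
  (forall A : set (R * R), measurable A ->
      mu1 A = (\int[g]_(z in (fun z => theta z.2) @^-1` A) (sqnorm z.2)%:E)%E).

Definition esqrt (x : \bar R) : \bar R :=
  match x with
  | r%:E => (Num.sqrt r)%:E
  | +oo%E => +oo%E
  | -oo%E => -oo%E
  end.

(* Wasserstein–Fisher–Rao distance U(μ0, μ1) (= +oo if Γ is empty) *)
Definition WFR (mu0 mu1 : {measure set (R * R)%type -> \bar R}) : \bar R :=
  ereal_inf [set e | exists g, is_plan mu0 mu1 g /\
      e = esqrt (\int[g]_z (sqdist z.1 z.2)%:E)%E].

Definition WFR_ball (lam : R) (mu1 : {measure set (R * R)%type -> \bar R})
    (mu0 : {measure set (R * R)%type -> \bar R}) : Prop :=
  Mplus mu0 /\ (WFR mu0 mu1 <= lam%:E)%E.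

Definition int_circle (f : R * R -> R)
    (mu : {measure set (R * R)%type -> \bar R}) : \bar R :=
  (\int[mu]_(x in circle) (f x)%:E)%E.

Definition usc_on_circle (f : R * R -> R) : Prop :=
  forall x, circle x -> forall e : R, 0 < e ->
    \forall y \near x, circle y -> f y < f x + e.

Definition is_discrete_measure (mu : {measure set (R * R)%type -> \bar R})
    (M : nat) (p : 'I_M -> R * R) (w : 'I_M -> R) : Prop :=
  forall A : set (R * R), measurable A ->
    mu A = (\sum_(k < M) (w k)%:E * \d_(p k) A)%E.

End WFR.

(* Main.v *)
Require Import Defs.
From mathcomp Require Import all_boot all_order all_algebra.
From mathcomp Require Import all_classical all_reals all_analysis measurable_realfun.
From mathcomp Require Import ring lra.
Set Implicit Arguments. Unset Strict Implicit. Unset Printing Implicit Defensive.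
Import Order.TTheory GRing.Theory Num.Theory.
Import numFieldNormedType.Exports.
Local Open Scope ring_scope.

(* A plan between mu_0 and the atomic measure mu_1 splits mu_0 into the parts sent to
   the atoms x_j and a remainder. By Cauchy-Schwarz the cheapest way to realise a given
   splitting (mu^j) costs |mu_0| + |mu_1| - 2 sum_j sqrt (r_j Q_j), where Q_j is the
   integral of max(0, <., x_j>)^2 against mu^j. Hence only the N + 2 linear functionals
   |mu_0|, int f dmu_0 and (Q_j)_j of the splitting matter. After pushing each mu^j onto
   an almost-maximal point of f in every cell of a fine grid, Caratheodory's theorem for
   cones in R^(N+2) leaves N + 2 atoms, at the price of an arbitrarily small error. The
   configurations of N + 2 atoms satisfying the cost bound are compact and the objective
   is upper semicontinuous on them, so letting the error tend to 0 yields a maximizer. *)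

(** * Caratheodory's theorem for finitely generated cones *)

(** The matrix with rows [v i], [i] in [S], has more rows than columns, so its left kernel contains
    a nonzero vector; this vector is extended by 0 outside [S]. *)
Lemma exists_linear_dependence (F : fieldType) d (I : finType) (v : I -> 'rV[F]_d)
    (S : {set I}) : (d < #|S|)%N ->
  exists c : I -> F, [/\ forall i, i \notin S -> c i = 0,
    exists i, c i != 0 & \sum_i c i *: v i = 0].
Proof.
move=> dS; pose A := \matrix_(k < #|S|) v (enum_val k).
have : kermx A != 0.
  by rewrite kermx_eq0 -row_leq_rank -ltnNge (leq_ltn_trans (rank_leq_col A)).
case/rowV0Pn => u /sub_kermxP uA u0.
(* At most one [k] enumerates [i], so this sum is the coefficient of [i], or 0 when [i] is not in
   [S]. *)
pose c i := \sum_(k < #|S| | enum_val k == i) u 0 k.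
have cE k : c (enum_val k) = u 0 k.
  rewrite /c (eq_bigl (pred1 k)) ?big_pred1_eq// => k' /=.
  by rewrite (inj_eq enum_val_inj).
exists c; split.
- move=> i iS; rewrite /c big1// => k /eqP ki.
  by rewrite -ki enum_valP in iS.
- case/rV0Pn : u0 => k uk; exists (enum_val k); by rewrite cE.
- rewrite -[RHS]uA mulmx_sum_row.
  rewrite (bigID (mem S)) /= addrC big1 ?add0r; last first.
    by move=> i iS; rewrite /c big1 ?scale0r// => k /eqP ki; rewrite -ki enum_valP in iS.
  rewrite big_enum_val /=; apply: eq_bigr => k _; by rewrite cE rowK.
Qed.

(** Induction on the size of the support: while it exceeds [d], a linear dependence supported in it
    is subtracted until a coefficient vanishes. *)
Lemma conic_caratheodory (R : realFieldType) d (I : finType) (v : I -> 'rV[R]_d)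
    (w : I -> R) : (forall i, 0 <= w i) ->
  exists w' : I -> R, [/\ forall i, 0 <= w' i,
    \sum_i w' i *: v i = \sum_i w i *: v i & (#|[set i | w' i != 0%R]| <= d)%N].
Proof.
have [n] := ubnP #|[set i | w i != 0]|; elim: n => // n IHn in w *.
move=> wn w0; have [wd|dw] := leqP #|[set i | w i != 0]| d; first by exists w.
have [c [cS [i0 ci0] cv]] :
    exists c : I -> R, [/\ forall i, w i = 0 -> c i = 0,
    exists i, 0 < c i & \sum_i c i *: v i = 0].
  have [c [cS [i0 ci0] cv]] := exists_linear_dependence v dw.
  have cS' i : w i = 0 -> c i = 0 by move=> wi; apply: cS; rewrite inE wi eqxx.
  (* The dependence is negated if necessary, so that it has a positive coefficient. *)
  have [c0|c0|/eqP] := ltrgtP (c i0) 0; last by rewrite (negPf ci0).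
    exists (fun i => - c i); split.
    - by move=> i /cS' ->; rewrite oppr0.
    - by exists i0; rewrite oppr_gt0.
    - under eq_bigr do rewrite scaleNr.
      by rewrite sumrN cv oppr0.
  by exists c; split => //; exists i0.
(* The least ratio is the largest multiple of [c] that can be subtracted with all weights staying
   nonnegative; it cancels the weight at [i1]. *)
case: (@arg_minP _ R _ i0 (fun i => 0 < c i) (fun i => w i / c i) ci0) => i1 ci1 imin.
pose w' i := w i - w i1 / c i1 * c i.
have w'0 i : 0 <= w' i.
  rewrite subr_ge0; have [ci|ci] := ltP 0 (c i).
    by rewrite -ler_pdivlMr ?imin.
  apply: le_trans (w0 i); rewrite mulr_ge0_le0//.
  by rewrite divr_ge0// ltW.
have w'v : \sum_i w' i *: v i = \sum_i w i *: v i.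
  under eq_bigr do rewrite scalerBl -scalerA.
  by rewrite sumrB -scaler_sumr cv scaler0 subr0.
have [|w2 [w20 w2v w2d]] := IHn w' _ w'0; last first.
  by exists w2; split => //; rewrite w2v.
rewrite -ltnS; apply: leq_trans wn; rewrite ltnS proper_card//.
apply/properP; split.
  apply/fintype.subsetP => i; rewrite !inE; apply: contra_neq => wi.
  by rewrite /w' wi (cS i wi) mulr0 subr0.
exists i1; rewrite !inE.
  by apply: contraTneq ci1 => /cS ->; rewrite ltxx.
by rewrite negbK /w' divfK ?subrr// gt_eqF.
Qed.

(** Indexing by exactly [d] slots: a smaller support is padded with zero weights, and [i0] serves as
    the default of [nth]. *)
Lemma conic_caratheodory_ord (R : realFieldType) d (I : finType) (i0 : I)
    (v : I -> 'rV[R]_d) (w : I -> R) : (forall i, 0 <= w i) ->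
  exists (s : 'I_d -> I) (u : 'I_d -> R), (forall k, 0 <= u k) /\
    \sum_k u k *: v (s k) = \sum_i w i *: v i.
Proof.
move=> /(conic_caratheodory v)[w' [w'0 <- cd]].
set S := [set i | w' i != 0] in cd.
pose s (k : 'I_d) := nth i0 (enum S) k.
exists s, (fun k : 'I_d => if (k < #|S|)%N then w' (s k) else 0); split.
  by move=> k; case: ifP.
rewrite [RHS](bigID (mem S)) /= [X in _ + X]big1 ?addr0; last first.
  by move=> i; rewrite inE negbK => /eqP ->; rewrite scale0r.
rewrite -[RHS]big_enum /= (big_nth i0) -cardE big_mkord.
rewrite (big_ord_widen _ (fun i : nat => w' (nth i0 (enum S) i) *: v (nth i0 (enum S) i)) cd).
rewrite [RHS]big_mkcond /=; apply: eq_bigr => k _.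
by case: ifP; rewrite ?scale0r.
Qed.

Local Open Scope classical_set_scope.

(** * Geometry of the plane and measurability *)

Section measurability.
Context {R : realType}.

Lemma measurable_sqnorm : measurable_fun [set: R * R] (@sqnorm R).
Proof.
by apply: measurable_funD; apply: measurable_funX;
  [exact: measurable_fst|exact: measurable_snd].
Qed.

Lemma measurable_sqdist :
  measurable_fun [set: (R * R) * (R * R)] (fun z => sqdist z.1 z.2).
Proof.
by apply: measurable_funD; apply: measurable_funX; apply: measurable_funB;
  (apply: measurableT_comp; [exact: measurable_fst || exact: measurable_snd|
     exact: measurable_fst || exact: measurable_snd]).
Qed.

Lemma measurable_circle : measurable (@circle R).
Proof.
rewrite (_ : @circle R = setT `&` (@sqnorm R) @^-1` [set 1]).
  exact: measurable_sqnorm.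
by rewrite setTI.
Qed.

Lemma measurable_point (p : R * R) : measurable [set p].
Proof.
rewrite (_ : [set p] = [set p.1] `*` [set p.2]); first exact: measurableX.
by apply/seteqP; split => [q -> //|[a b] /= [-> ->]]; case: p.
Qed.

Lemma sqnorm_ge0 (p : R * R) : 0 <= sqnorm p.
Proof. by rewrite /sqnorm addr_ge0// sqr_ge0. Qed.

Lemma sqnorm_gt0 (p : R * R) : p != (0, 0) -> 0 < sqnorm p.
Proof.
rewrite lt_neqAle sqnorm_ge0 andbT; apply: contra.
case: p => a b; rewrite eq_sym /sqnorm/= paddr_eq0 ?sqr_ge0// !sqrf_eq0.
by move=> /andP[/eqP -> /eqP ->].
Qed.

Lemma measurable_theta : measurable_fun setT (@theta R).
Proof.
(* Off the origin this is the inverse of the norm, written as a composition of measurable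
   functions. *)
have mv : measurable_fun [set: R * R] (fun p => expR (- ln (Num.sqrt (sqnorm p)))).
  apply: (measurableT_comp (@measurable_expR R)).
  apply: (measurableT_comp (@oppr_measurable R setT)).
  apply: (measurableT_comp (@measurable_ln R)).
  have ms : measurable_fun setT (@Num.sqrt R).
    by apply: continuous_measurable_fun; exact: sqrt_continuous.
  exact: (measurableT_comp ms measurable_sqnorm).
rewrite (_ : @theta R = fun p : R * R => if p == (0, 0) then (1, 0)
   else (p.1 * expR (- ln (Num.sqrt (sqnorm p))), p.2 * expR (- ln (Num.sqrt (sqnorm p))))).
  apply: measurable_fun_ifT.
  - apply: (measurable_fun_bool true); rewrite setTI.
    rewrite (_ : _ @^-1` _ = [set (0, 0)]); first exact: measurable_point.
    by apply/seteqP; split => [p /= /eqP|p /= ->] //; rewrite eqxx.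
  - exact: measurable_cst.
  - by apply: measurable_fun_pair; apply: measurable_funM.
apply/funext => p; rewrite /theta; case: ifPn => // p0.
by rewrite expRN lnK// posrE sqrtr_gt0 sqnorm_gt0.
Qed.

Lemma theta_circle (p : R * R) : circle (theta p).
Proof.
rewrite /circle /= /theta; case: ifPn => [_|p0]; rewrite /sqnorm/=.
  by rewrite expr1n expr0n/= addr0.
rewrite !exprMn -mulrDl exprVn sqr_sqrtr ?addr_ge0 ?sqr_ge0//.
by rewrite divff// gt_eqF// sqnorm_gt0.
Qed.

Lemma polar_decomposition (p : R * R) :
  p = (Num.sqrt (sqnorm p) * (theta p).1, Num.sqrt (sqnorm p) * (theta p).2).
Proof.
rewrite /theta; case: ifPn => [/eqP ->|p0].
  by rewrite /sqnorm/= expr0n/= addr0 sqrtr0 !mul0r.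
have s0 : Num.sqrt (sqnorm p) != 0 by rewrite gt_eqF// sqrtr_gt0 sqnorm_gt0.
by rewrite /= ![_ * (_ / _)]mulrC !divfK//; case: p {p0 s0}.
Qed.

Lemma theta_scale (a : R) (p : R * R) : 0 < a -> circle p ->
  theta (a * p.1, a * p.2) = p.
Proof.
case: p => u v a0; rewrite /circle/= /sqnorm/= => uv.
have e : sqnorm (a * u, a * v) = a ^+ 2.
  by rewrite /sqnorm/= !exprMn -mulrDr uv mulr1.
rewrite /theta e sqrtr_sqr gtr0_norm//; case: ifPn => [/eqP[au av]|_] /=.
  have := e; rewrite au av /sqnorm/= expr0n/= addr0 => /esym/eqP.
  by rewrite sqrf_eq0 (gt_eqF a0).
by rewrite ![a * _]mulrC !mulfK// gt_eqF.
Qed.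


(** Upper semicontinuity makes each set [f < c] relatively open in the circle, hence the trace of a
    countable union of open rational boxes. *)
Lemma measurable_usc (f : R * R -> R) : usc_on_circle f -> measurable_fun (@circle R) f.
Proof.
move=> uf; apply: (measurability _ (RGenInftyO.measurableE R)) => //.
move=> _ [_ [c ->] <-].
pose box (q : (rat * rat) * (rat * rat)) : set (R * R) :=
  `]ratr q.1.1, ratr q.1.2[%classic `*` `]ratr q.2.1, ratr q.2.2[%classic.
pose P := [set q | box q `&` @circle R `<=` [set p | f p < c]].
rewrite (_ : _ `&` _ = @circle R `&` \bigcup_q (if q \in P then box q else set0)).
  apply: measurableI; first exact: measurable_circle.
  apply: countable_bigcupT_measurable => // q; case: ifP => // _.
  by apply: measurableX; exact: measurable_itv.
apply/seteqP; split => [p [cp]|p [cp]]; last first.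
  rewrite -bigcup_mkcond => -[q Pq bqp].
  by split => //=; rewrite in_itv/=; exact: Pq.
rewrite /= in_itv/= => fpc; split => //; rewrite -bigcup_mkcond.
have := uf p cp (c - f p); rewrite subr_gt0 => /(_ fpc).
rewrite addrC subrK.
move=> [[A B] /= [nA nB] AB].
have [e1 /= e10 Ae1] := nA; have [e2 /= e20 Be2] := nB.
have /rat_in_itvoo[q1 /itvP q1P] : p.1 - e1 < p.1 by rewrite gtrBl.
have /rat_in_itvoo[q2 /itvP q2P] : p.1 < p.1 + e1 by rewrite ltrDl.
have /rat_in_itvoo[q3 /itvP q3P] : p.2 - e2 < p.2 by rewrite gtrBl.
have /rat_in_itvoo[q4 /itvP q4P] : p.2 < p.2 + e2 by rewrite ltrDl.
exists ((q1, q2), (q3, q4)); last by split; rewrite /= in_itv/= ?q1P ?q2P ?q3P ?q4P.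
move=> z [[/= + +] cz]; rewrite !in_itv/= => /andP[z1 z2] /andP[z3 z4].
have h1 : p.1 - e1 < ratr q1 by rewrite q1P.
have h2 : ratr q2 < p.1 + e1 by rewrite q2P.
have h3 : p.2 - e2 < ratr q3 by rewrite q3P.
have h4 : ratr q4 < p.2 + e2 by rewrite q4P.
apply: (AB z) => //; split; [apply: Ae1|apply: Be2];
  rewrite /ball_/= ltr_norml; apply/andP; split; lra.
Qed.

End measurability.

(** * Limits along an ultrafilter *)

Section ultra.
Context {R : realType} {T : Type} (U : set_system T) {UU : UltraFilter U}.

(** Compactness of the segment gives a cluster point, and a cluster point of an ultrafilter is a
    limit. Several sequences thus converge along one ultrafilter without successive extraction of
    subsequences. *)
Lemma ultra_bounded_cvg (u : T -> R) (b : R) :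
  (forall n, `|u n| <= b) -> exists l : R, u @ U --> l.
Proof.
move=> ub; have [|l [_ cl]] := @segment_compact R (- b) b (u @ U) _.
  by apply: (@filterS _ U _ setT) filterT => n _ /=; rewrite in_itv/= -ler_norml.
exists l => B /= lB; have [//|UnB] := in_ultra_setVsetC (u @^-1` B) UU.
by have [y [/= nBy /nBy]] := cl (~` B) B UnB lB.
Qed.

End ultra.

Lemma cvg_sumr {R : realType} {T : Type} (F : set_system T) {FF : Filter F} (I : finType)
    (u : I -> T -> R) (a : I -> R) :
  (forall i, u i @ F --> a i) -> \sum_i u i n @[n --> F] --> \sum_i a i.
Proof. by move=> ua; apply: cvg_big => [|i _]; [exact: add_continuous|exact: ua]. Qed.

Section circle.
Context {R : realType}.

Lemma circle_norm_le1 (p : R * R) : circle p -> `|p.1| <= 1 /\ `|p.2| <= 1.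
Proof.
rewrite /circle/= /sqnorm => h.
by split; rewrite ler_norml; apply/andP; split; nra.
Qed.

Context {T : Type} (U : set_system T) {UU : UltraFilter U}.

Lemma ultra_circle_cvg (t : T -> R * R) : (forall n, circle (t n)) ->
  exists2 l : R * R, circle l & t @ U --> l.
Proof.
move=> ct.
have [l1 tl1] : exists l : R, (fst \o t) @ U --> l.
  by apply: (@ultra_bounded_cvg _ _ _ _ _ 1) => n /=; have [] := circle_norm_le1 (ct n).
have [l2 tl2] : exists l : R, (snd \o t) @ U --> l.
  by apply: (@ultra_bounded_cvg _ _ _ _ _ 1) => n /=; have [] := circle_norm_le1 (ct n).
exists (l1, l2); last first.
  rewrite (_ : t = fun n => ((fst \o t) n, (snd \o t) n)).
    exact: (cvg_pair tl1 tl2).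
  by apply/funext => n /=; case: (t n).
rewrite /circle /= /sqnorm /=.
have h : (fst \o t) n ^+ 2 + (snd \o t) n ^+ 2 @[n --> U] --> l1 ^+ 2 + l2 ^+ 2.
  by apply: cvgD; apply: cvgM.
have h1 : (fst \o t) n ^+ 2 + (snd \o t) n ^+ 2 @[n --> U] --> (1 : R).
  rewrite (_ : (fun n => _) = cst 1); first exact: cvg_cst.
  by apply/funext => n /=; have := ct n.
exact: (cvg_unique _ h h1).
Qed.

End circle.

Lemma usc_near_lt {R : realType} {T : Type} (F : set_system T) {FF : Filter F}
    (f : R * R -> R) (t : T -> R * R) l (e : R) : usc_on_circle f ->
  (forall n, circle (t n)) -> circle l -> t @ F --> l -> 0 < e ->
  \forall n \near F, f (t n) < f l + e.
Proof.
move=> uf ct cl tl e0; have /tl := uf l cl e e0.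
by rewrite !near_simpl; apply: filterS => n; apply; exact: ct.
Qed.

Lemma exists_ultra_oo : exists U : set_system nat, UltraFilter U /\ \oo `<=` U.
Proof. exact: ultraFilterLemma. Qed.

(** Otherwise there are points [t n] with [f (t n) > n], and a limit of [t] on the circle
    contradicts semicontinuity there. *)
Lemma usc_bounded_above {R : realType} (f : R * R -> R) : usc_on_circle f ->
  exists b : R, forall p, circle p -> f p <= b.
Proof.
move=> uf; apply: contrapT => /forallNP nb.
have /choice[t ht] : forall n : nat, exists p, circle p /\ n%:R < f p.
  move=> n; have /existsNP[p /not_implyP[cp /negP]] := nb n%:R.
  by rewrite -ltNge; exists p.
have [U [UU oU]] := exists_ultra_oo.
have [l cl tl] := ultra_circle_cvg (fun n => (ht n).1).
have h1 : \forall n \near U, f (t n) < f l + 1.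
  exact: (usc_near_lt uf (fun n => (ht n).1) cl tl ltr01).
have h2 : \forall n \near U, f l + 1 <= n%:R by apply: oU; exact: nbhs_infty_ger.
have [n [h3 h4]] := @filter_ex _ _ _ _ (filterI h1 h2).
by have := lt_le_trans (ht n).2 (le_trans (ltW h3) h4); rewrite ltxx.
Qed.

(** * Finite sums of Dirac masses *)

Section dirac_sum.
Context {R : realType} {d : measure_display} {T : measurableType d}.

Lemma exists_dirac_sum (I : finType) (p : I -> T) (w : I -> R) :
  (forall i, 0 <= w i) ->
  exists m : {measure set T -> \bar R},
    (forall A, m A = \sum_i (w i)%:E * \d_(p i) A)%E /\
    (forall D (f : T -> \bar R), measurable D -> measurable_fun D f ->
       (forall y, D y -> (0 <= f y)%E) ->
       (\int[m]_(y in D) f y = \sum_i (w i)%:E * (\d_(p i) D * f (p i)))%E).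
Proof.
move=> w0.
(* [msum] is indexed by natural numbers: [I] is enumerated, and indices beyond its cardinal get the
   zero measure. *)
pose m_ (n : nat) : {measure set T -> \bar R} :=
  if insub n is Some k then
    mscale (NngNum (w0 (enum_val (k : 'I_#|I|)))) \d_(p (enum_val k)) else mzero.
have mE (k : 'I_#|I|) : m_ k =
    mscale (NngNum (w0 (enum_val k))) \d_(p (enum_val k)) :> {measure set T -> \bar R}.
  by rewrite /m_ valK.
exists (msum m_ #|I|); split=> [A|D f mD mf f0].
  rewrite /msum (reindex_onto enum_val enum_rank) => [|i _]; last exact: enum_rankK.
  rewrite (eq_bigl predT) => [|k]; last by rewrite enum_valK eqxx.
  by apply: eq_bigr => k _; rewrite mE /mscale/=.
rewrite ge0_integral_measure_sum//.
rewrite [RHS](reindex_onto enum_val enum_rank) => [|i _]; last exact: enum_rankK.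
rewrite [RHS](eq_bigl predT) => [|k]; last by rewrite enum_valK eqxx.
apply: eq_bigr => k _; rewrite mE ge0_integral_mscale//=.
by rewrite integral_dirac.
Qed.

(** The integrand may change sign: its positive and negative parts are integrated separately, both
    with finite value. *)
Lemma integral_dirac_sum (I : finType) (p : I -> T) (w : I -> R)
    (m : {measure set T -> \bar R}) (D : set T) (f : T -> R) :
  (forall i, 0 <= w i) -> measurable D -> measurable_fun D f -> 
  (forall i, D (p i)) ->
  (forall A, measurable A -> m A = \sum_i (w i)%:E * \d_(p i) A)%E ->
  (\int[m]_(y in D) (f y)%:E = (\sum_i w i * f (p i))%:E)%E.
Proof.
move=> w0 mD mf Dp mE; have [m' [m'E m'I]] := exists_dirac_sum p w0.
rewrite (eq_measure_integral m'); last by move=> A mA _; rewrite mE.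
have mEf : measurable_fun D (fun y => (f y)%:E) by exact/measurable_EFinP.
have pE g (i : I) : ((w i)%:E * (\d_(p i) D * g (p i)) = (w i)%:E * g (p i))%E.
  by rewrite diracE mem_set ?mul1e.
rewrite integralE !m'I//; [|exact: measurable_funeneg|exact: measurable_funepos].
under eq_bigr do rewrite pE; under [X in (_ - X)%E]eq_bigr do rewrite pE.
under eq_bigr do rewrite funeposE -EFin_max -EFinM.
under [X in (_ - X)%E]eq_bigr do rewrite funenegE -EFinN -EFin_max -EFinM.
rewrite !sumEFin -EFinB -sumrB; congr EFin; apply: eq_bigr => i _.
by rewrite -mulrBr; congr (_ * _); rewrite /Num.max; do 2 case: ifP; lra.
Qed.

End dirac_sum.

(** * The finite-dimensional problem *)

Definition dotp {R : realType} (p q : R * R) : R := p.1 * q.1 + p.2 * q.2.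
(** For unit vectors, the positive part of the cosine of their angle. At a nonpositive cosine,
    transport is no cheaper than destroying and creating the mass. *)
Definition cospos {R : realType} (p q : R * R) : R := Num.max 0 (dotp p q).

(* [w k] is the mass of [mu0] at [t k], of which [a k j] is transported to [x j] and
   the rest is destroyed. For fixed [a] the cheapest plan costs
   [sum w + sum r - 2 sum_j sqrt (r_j Q_j)] with [Q_j = sum_k a_kj cospos(t_k, x_j)^2];
   [e] relaxes that cost bound. *)
Definition feasible {R : realType} (lam : R) N (x : 'I_N -> R * R) (r : 'I_N -> R) M (e : R)
    (t : 'I_M -> R * R) (w : 'I_M -> R) (a : 'I_M -> 'I_N -> R) : Prop :=
  [/\ forall k, circle (t k), forall k j, 0 <= a k j, forall k, \sum_j a k j <= w k
    & \sum_k w k + \sum_j r j <= lam ^+ 2 + e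
       + 2 * \sum_j Num.sqrt (r j * (\sum_k a k j * cospos (t k) (x j) ^+ 2 + e))].

(** * Plans built from feasible configurations *)

Section plan_of_feasible.
Context {R : realType}.

Definition scalep (s : R) (p : R * R) : R * R := (s * p.1, s * p.2).

Lemma sqnorm_scalep (a : R) p : 0 <= a -> circle p -> sqnorm (scalep (Num.sqrt a) p) = a.
Proof.
move=> a0; rewrite /circle/= /sqnorm/= => cp.
by rewrite !exprMn -mulrDr cp mulr1 sqr_sqrtr.
Qed.

(** At [a = 0] the direction is lost, since [theta] takes its default value, but the weight is then
    0 on both sides. *)
Lemma scalep_weight (a : R) p (A : set (R * R)) : 0 <= a -> circle p ->
  sqnorm (scalep (Num.sqrt a) p) * (theta (scalep (Num.sqrt a) p) \in A)%:R =
  a * (p \in A)%:R.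
Proof.
move=> a0 cp; rewrite sqnorm_scalep//; have [->|an0] := eqVneq a 0.
  by rewrite !mul0r.
by rewrite theta_scale// sqrtr_gt0 lt_neqAle eq_sym an0.
Qed.

Lemma sqdist_scalep (s u : R) p q : circle p -> circle q ->
  sqdist (scalep s p) (scalep u q) = s ^+ 2 + u ^+ 2 - 2 * (s * u * dotp p q).
Proof.
rewrite /circle/= /sqnorm /sqdist/dotp /= => cp cq.
transitivity (s ^+ 2 * (p.1 ^+ 2 + p.2 ^+ 2) + u ^+ 2 * (q.1 ^+ 2 + q.2 ^+ 2)
  - 2 * (s * u * (p.1 * q.1 + p.2 * q.2))); first by ring.
by rewrite cp cq !mulr1.
Qed.

Lemma cosposM (p q : R * R) : cospos p q * dotp p q = cospos p q ^+ 2.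
Proof. by rewrite /cospos expr2; case: (leP 0 (dotp p q)) => // _; rewrite !mul0r. Qed.

Lemma cospos_ge0 (p q : R * R) : 0 <= cospos p q.
Proof. by rewrite /cospos le_max lexx. Qed.

Lemma measurable_fst_sqnorm :
  measurable_fun setT (fun z : (R * R) * (R * R) => sqnorm z.1).
Proof. exact: (measurableT_comp measurable_sqnorm measurable_fst). Qed.

Lemma measurable_snd_sqnorm :
  measurable_fun setT (fun z : (R * R) * (R * R) => sqnorm z.2).
Proof. exact: (measurableT_comp measurable_sqnorm measurable_snd). Qed.

Lemma measurable_theta1 (A : set (R * R)) : measurable A ->
  measurable ((fun z : (R * R) * (R * R) => theta z.1) @^-1` A).
Proof.
move=> mA; rewrite -[X in measurable X]setTI.
exact: (measurableT_comp measurable_theta measurable_fst).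
Qed.

Lemma measurable_theta2 (A : set (R * R)) : measurable A ->
  measurable ((fun z : (R * R) * (R * R) => theta z.2) @^-1` A).
Proof.
move=> mA; rewrite -[X in measurable X]setTI.
exact: (measurableT_comp measurable_theta measurable_snd).
Qed.

Lemma sqdist_ge0 (p q : R * R) : 0 <= sqdist p q.
Proof. by rewrite /sqdist addr_ge0// sqr_ge0. Qed.

Context (lam : R) (N : nat) (x : 'I_N -> R * R) (r : 'I_N -> R).
Hypotheses (lam0 : 0 <= lam) (cx : forall j, circle (x j)) (r0 : forall j, 0 < r j).
Context (M : nat) (t : 'I_M -> R * R) (w : 'I_M -> R) (a : 'I_M -> 'I_N -> R).
Hypothesis fea : feasible lam x r 0 t w a.

Let Q j := \sum_k a k j * cospos (t k) (x j) ^+ 2.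

(* Equality case of Cauchy-Schwarz between [a _ j] and [b _ j]. *)
Let b k j := r j * (a k j * cospos (t k) (x j) ^+ 2) / Q j.

Let ct k : circle (t k). Proof. by have [] := fea. Qed.
Let a0 k j : 0 <= a k j. Proof. by have [] := fea. Qed.
Let aw k : 0 <= w k - \sum_j a k j. Proof. by rewrite subr_ge0; have [] := fea. Qed.

Let Q0 j : 0 <= Q j.
Proof. by apply: sumr_ge0 => k _; rewrite mulr_ge0// sqr_ge0. Qed.

Let b0 k j : 0 <= b k j.
Proof. by apply: divr_ge0 => //; apply: mulr_ge0; [exact: ltW|rewrite mulr_ge0// sqr_ge0]. Qed.

(** If [Q j] is nonzero the [b k j] exhaust [r j]; if it is 0 they all vanish, and the whole of
    [r j] is created. *)
Let br j : 0 <= r j - \sum_k b k j.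
Proof.
rewrite /b -mulr_suml -mulr_sumr -/(Q j).
have [->|Qn0] := eqVneq (Q j) 0; first by rewrite mulr0 mul0r subr0 ltW.
by rewrite mulfK// subrr.
Qed.

(** By the choice of [b], each term equals [a k j * cospos (t k) (x j) ^+ 2] times the common factor
    [sqrt (r j / Q j)]. *)
Let sumQ j : \sum_k Num.sqrt (a k j) * Num.sqrt (b k j) * dotp (t k) (x j)
  = Num.sqrt (r j * Q j).
Proof.
have [Q0j|Qn0] := eqVneq (Q j) 0.
  rewrite Q0j mulr0 sqrtr0 big1// => k _.
  by rewrite /b Q0j invr0 mulr0 sqrtr0 mulr0 mul0r.
transitivity (\sum_k (a k j * cospos (t k) (x j) ^+ 2) * Num.sqrt (r j / Q j)).
  apply: eq_bigr => k _; rewrite -sqrtrM// /b.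
  rewrite (_ : _ * (_ / _) = (a k j * cospos (t k) (x j)) ^+ 2 * (r j / Q j)); last by ring.
  rewrite sqrtrM ?sqr_ge0// sqrtr_sqr ger0_norm ?mulr_ge0 ?cospos_ge0//.
  by rewrite -cosposM; ring.
rewrite -mulr_suml -/(Q j) -{1}[Q j]ger0_norm// -(@sqrtr_sqr _ (Q j)) -sqrtrM ?sqr_ge0//.
by congr Num.sqrt; rewrite expr2 mulrACA mulfV// mulr1 mulrC.
Qed.

(** Atoms of the plan: a pair carries mass from [t k] to [x j], a single [k] is mass destroyed at
    [t k], a single [j] mass created at [x j]. The origin is written [scalep (Num.sqrt 0) _] so that
    the same formulas cover all three. *)
Let K : finType := (('I_M * 'I_N) + ('I_M + 'I_N))%type.

Let p0 (i : K) : R * R := match i with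
  | inl kj => scalep (Num.sqrt (a kj.1 kj.2)) (t kj.1)
  | inr (inl k) => scalep (Num.sqrt (w k - \sum_j a k j)) (t k)
  | inr (inr j) => scalep (Num.sqrt 0) (x j)
  end.

Let p1 (i : K) : R * R := match i with
  | inl kj => scalep (Num.sqrt (b kj.1 kj.2)) (x kj.2)
  | inr (inl k) => scalep (Num.sqrt 0) (t k)
  | inr (inr j) => scalep (Num.sqrt (r j - \sum_k b k j)) (x j)
  end.

Let sumK (F : K -> R) :
  \sum_i F i = \sum_k \sum_j F (inl (k, j)) + (\sum_k F (inr (inl k)) + \sum_j F (inr (inr j))).
Proof. by rewrite !big_sumType /= pair_bigA/=; congr (_ + _); apply: eq_bigr => -[]. Qed.

Let weight0 (A : set (R * R)) :
  \sum_i sqnorm (p0 i) * (theta (p0 i) \in A)%:R = \sum_k w k * (t k \in A)%:R.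
Proof.
rewrite sumK /=.
rewrite addrA [X in _ + X = _]big1 ?addr0; last first.
  by move=> j _; rewrite scalep_weight// mul0r.
rewrite -big_split/=; apply: eq_bigr => k _.
rewrite scalep_weight//; under eq_bigr do rewrite scalep_weight//.
by rewrite -mulr_suml -mulrDl addrC subrK.
Qed.

Let weight1 (A : set (R * R)) :
  \sum_i sqnorm (p1 i) * (theta (p1 i) \in A)%:R = \sum_j r j * (x j \in A)%:R.
Proof.
rewrite sumK /= [X in _ + (X + _) = _]big1 ?add0r; last first.
  by move=> k _; rewrite scalep_weight// mul0r.
rewrite exchange_big -big_split/=; apply: eq_bigr => j _.
rewrite scalep_weight//; under eq_bigr do rewrite scalep_weight//.
by rewrite -mulr_suml -mulrDl addrC subrK.
Qed.

Let cost : \sum_i sqdist (p0 i) (p1 i) <= lam ^+ 2.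
Proof.
rewrite sumK /=.
under eq_bigr do under eq_bigr do rewrite sqdist_scalep// !sqr_sqrtr//.
under [X in _ + (X + _)]eq_bigr do
  rewrite sqdist_scalep// sqrtr0 expr0n/= addr0 mulr0 mul0r mulr0 subr0 sqr_sqrtr//.
under [X in _ + (_ + X)]eq_bigr do
  rewrite sqdist_scalep// sqrtr0 expr0n/= add0r !mul0r mulr0 subr0 sqr_sqrtr//.
rewrite !sumrB.
under eq_bigr do rewrite sumrB big_split/=.
rewrite sumrB big_split/=.
rewrite [X in _ + X - _ + _]exchange_big/=.
under [X in _ - X + _]eq_bigr do rewrite -mulr_sumr.
rewrite -mulr_sumr [X in 2 * X]exchange_big/=.
under [X in 2 * X]eq_bigr do rewrite sumQ.
have [_ _ _] := fea; rewrite addr0.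
under [X in 2 * X]eq_bigr do rewrite addr0.
rewrite -/Q; lra.
Qed.

Lemma plan_of_feasible (mu1 : {measure set (R * R)%type -> \bar R}) :
  is_discrete_measure mu1 x r ->
  exists mu0 : {measure set (R * R)%type -> \bar R},
    WFR_ball lam mu1 mu0 /\ is_discrete_measure mu0 t w.
Proof.
move=> mu1E.
have w0 k : 0 <= w k.
  by have := aw k; rewrite subr_ge0; apply: le_trans; exact: sumr_ge0.
have [mu0 [mu0E mu0I]] := exists_dirac_sum t w0.
(* All weights are 1, because the masses are encoded in the radii of [p0] and [p1]. *)
have [g [gE gI]] := @exists_dirac_sum R _ _ _ (fun i : K => (p0 i, p1 i)) (fun=> 1) (fun=> ler01).
exists mu0; split; last by move=> A mA; rewrite mu0E.
split.
  split.
    rewrite mu0E; under eq_bigr do rewrite diracT mule1.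
    by rewrite sumEFin ltry.
  rewrite mu0E big1// => k _; rewrite diracE memNset ?mule0//.
  by apply; exact: ct.
have [m1 m2] := (measurable_fst_sqnorm, measurable_snd_sqnorm).
have intg (F : (R * R) * (R * R) -> R) : measurable_fun setT F -> (forall z, 0 <= F z) ->
    (\int[g]_z (F z)%:E = (\sum_i F (p0 i, p1 i))%:E)%E.
  move=> mF F0; rewrite gI//; last 2 first.
  - exact/measurable_EFinP.
  - by move=> z _; rewrite lee_fin.
  by under eq_bigr do rewrite diracT !mul1e; rewrite sumEFin.
have intg' (F : (R * R) * (R * R) -> R) D : measurable D -> measurable_fun setT F ->
   (forall z, 0 <= F z) ->
    (\int[g]_(z in D) (F z)%:E = (\sum_i F (p0 i, p1 i) * ((p0 i, p1 i) \in D)%:R)%:E)%E.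
  move=> mD mF F0; rewrite gI//; last 2 first.
  - apply/measurable_EFinP; exact: measurable_funTS.
  - by move=> z _; rewrite lee_fin.
  by under eq_bigr do rewrite diracE mul1e -EFinM mulrC; rewrite sumEFin.
apply: (@le_trans _ _ (esqrt (\int[g]_z (sqdist z.1 z.2)%:E)%E)); last first.
  rewrite intg; [|exact: measurable_sqdist|by move=> z; exact: sqdist_ge0].
  rewrite /esqrt lee_fin -[leRHS]ger0_norm// -sqrtr_sqr ler_wsqrtr//; exact: cost.
apply: ereal_inf_lbound; exists g; split => //; split.
  rewrite intg ?ltry//; first exact: measurable_funD.
  by move=> z; rewrite addr_ge0// sqnorm_ge0.
split => A mA.
- rewrite intg'//; [|exact: measurable_theta1|by move=> z; exact: sqnorm_ge0].
  rewrite mu0E; under eq_bigr do rewrite diracE -EFinM.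
  by rewrite sumEFin; congr EFin; rewrite -weight0.
- rewrite intg'//; [|exact: measurable_theta2|by move=> z; exact: sqnorm_ge0].
  rewrite mu1E//; under eq_bigr do rewrite diracE -EFinM.
  by rewrite sumEFin; congr EFin; rewrite -weight1.
Qed.

End plan_of_feasible.

(** * A priori bound on the mass *)

Section bounds.
Context {R : realType}.

Lemma dotp_le1 (p q : R * R) : circle p -> circle q -> dotp p q <= 1.
Proof.
rewrite /circle/= /sqnorm /dotp => cp cq.
have := sqr_ge0 (p.1 - q.1); have := sqr_ge0 (p.2 - q.2); nra.
Qed.

Lemma cospos2_le1 (p q : R * R) : circle p -> circle q -> cospos p q ^+ 2 <= 1.
Proof.
by move=> cp cq; rewrite exprn_ile1 ?cospos_ge0// /cospos ge_max ler01 dotp_le1.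
Qed.

Lemma sqrtM_le (r y : R) : 0 <= r -> 0 <= y -> 2 * Num.sqrt (r * y) <= 2 * r + y / 2.
Proof.
move=> r0 y0; have h : 0 <= r + y / 4 by lra.
have : Num.sqrt (r * y) <= r + y / 4.
  rewrite -[leRHS]ger0_norm// -sqrtr_sqr ler_wsqrtr//.
  by have := sqr_ge0 (r - y / 4); nra.
by lra.
Qed.

(** The sum of the [Q j] is at most the mass, and [sqrtM_le] gives it the coefficient 1/2, so the
    left side of the cost bound absorbs it. *)
Lemma feasible_mass (lam : R) N (x : 'I_N -> R * R) r M e (t : 'I_M -> R * R) w a :
  (forall j, circle (x j)) -> (forall j, 0 < r j) -> 0 <= e <= 1 ->
  feasible lam x r e t w a ->
  \sum_k w k <= 2 * (lam ^+ 2 + 1 + \sum_j r j) + N%:R.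
Proof.
move=> cx r0 /andP[e0 e1] [ct a0 aw fea].
pose Q j := \sum_k a k j * cospos (t k) (x j) ^+ 2.
have Q0 j : 0 <= Q j by apply: sumr_ge0 => k _; rewrite mulr_ge0// sqr_ge0.
have QW : \sum_j Q j <= \sum_k w k.
  rewrite /Q exchange_big /=; apply: ler_sum => k _; apply: le_trans (aw k).
  by apply: ler_sum => j _; rewrite ler_piMr// cospos2_le1.
have : 2 * \sum_j Num.sqrt (r j * (Q j + e)) <= \sum_j (2 * r j + (Q j + e) / 2).
  by rewrite mulr_sumr; apply: ler_sum => j _; apply: sqrtM_le; [exact: ltW|exact: addr_ge0].
rewrite big_split/= -mulr_sumr -mulr_suml big_split/= sumr_const card_ord -mulr_natr.
have : e * N%:R <= N%:R by rewrite ler_piMl.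
by move: fea; rewrite -/Q; lra.
Qed.

End bounds.

(** * Compactness of feasible configurations *)

Section limit.
Context {R : realType} (f : R * R -> R) (lam : R) (N : nat).
Context (x : 'I_N -> R * R) (r : 'I_N -> R) (M : nat).
Hypotheses (uf : usc_on_circle f) (cx : forall j, circle (x j)) (r0 : forall j, 0 < r j).

(** Points stay on the circle and weights below the mass bound, so everything converges along one
    ultrafilter. The constraints are continuous, and the objective is upper semicontinuous since the
    weights are nonnegative. *)
Lemma feasible_limit (v : R) :
  (forall n : nat, exists t w a, @feasible R lam N x r M n.+1%:R^-1 t w a /\
     v - n.+1%:R^-1 <= \sum_k w k * f (t k)) ->
  exists t w a, @feasible R lam N x r M 0 t w a /\ v <= \sum_k w k * f (t k).
Proof.
move=> H.
have /choice[c hc] : forall n : nat, exists c : ('I_M -> R * R) * ('I_M -> R) * ('I_M -> 'I_N -> R),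
   feasible lam x r n.+1%:R^-1 c.1.1 c.1.2 c.2 /\
     v - n.+1%:R^-1 <= \sum_k c.1.2 k * f (c.1.1 k).
  by move=> n; have [t [w [a h]]] := H n; exists (t, w, a).
pose t n := (c n).1.1; pose w n := (c n).1.2; pose a n := (c n).2.
have fea n : feasible lam x r n.+1%:R^-1 (t n) (w n) (a n) by have [] := hc n.
have obj n : v - n.+1%:R^-1 <= \sum_k w n k * f (t n k) by have [] := hc n.
have ct n k : circle (t n k) by have [] := fea n.
have a0 n k j : 0 <= a n k j by have [] := fea n.
have aw n k : \sum_j a n k j <= w n k by have [] := fea n.
have w0 n k : 0 <= w n k by apply: le_trans (aw n k); exact: sumr_ge0.
pose B := 2 * (lam ^+ 2 + 1 + \sum_j r j) + N%:R.
have wB n k : w n k <= B.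
  apply: le_trans (feasible_mass cx r0 _ (fea n)).
    by rewrite (bigD1 k)//= lerDl sumr_ge0.
  by rewrite invr_ge0 ler0n invf_le1 ?ltr0n// ler1n.
have aB n k j : a n k j <= B.
  apply: le_trans (wB n k); apply: le_trans (aw n k).
  by rewrite (bigD1 j)//= lerDl sumr_ge0.
have [U [UU oU]] := exists_ultra_oo.
have /choice[tl htl] : forall k, exists l, circle l /\ t n k @[n --> U] --> l.
  by move=> k; have [l ? ?] := ultra_circle_cvg (fun n => ct n k); exists l.
have /choice[wl hwl] : forall k, exists l : R, w n k @[n --> U] --> l.
  by move=> k; apply: (@ultra_bounded_cvg _ _ U _ _ B) => n; rewrite ger0_norm.
have /choice[al hal] : forall kj : 'I_M * 'I_N, exists l : R, a n kj.1 kj.2 @[n --> U] --> l.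
  by move=> k; apply: (@ultra_bounded_cvg _ _ U _ _ B) => n; rewrite ger0_norm.
have e0 : n.+1%:R^-1 @[n --> U] --> (0 : R).
  by move=> A /(@cvg_harmonic R) hA; exact: oU.
pose al' k j := al (k, j).
have hal' k j : a n k j @[n --> U] --> al' k j by exact: hal (k, j).
have htl1 k : (t n k).1 @[n --> U] --> (tl k).1.
  exact: cvg_comp (htl k).2 (@cvg_fst _ _ _ _ _).
have htl2 k : (t n k).2 @[n --> U] --> (tl k).2.
  exact: cvg_comp (htl k).2 (@cvg_snd _ _ _ _ _).
have hcos k j : cospos (t n k) (x j) @[n --> U] --> cospos (tl k) (x j).
  (* The maximum is expressed through the absolute value to obtain its continuity. *)
  rewrite /cospos; under eq_fun do rewrite maxr_absE.
  rewrite maxr_absE; apply: cvgM; last exact: cvg_cst.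
  have hd : dotp (t n k) (x j) @[n --> U] --> dotp (tl k) (x j).
    by apply: cvgD; apply: cvgM => //; exact: cvg_cst.
  apply: cvgD; first by apply: cvgD => //; exact: cvg_cst.
  by apply: cvg_norm; apply: cvgB => //; exact: cvg_cst.
have wl0 k : 0 <= wl k.
  apply: (ler_cvg_to (cvg_cst 0) (hwl k)).
  exact: filterE.
exists tl, wl, al'; split; last first.
  (* Semicontinuity costs [e] per unit of mass; dividing [e] by the total mass plus 1 also covers
     zero mass. *)
  suff key (e : R) : 0 < e -> v <= \sum_k wl k * f (tl k) + e * \sum_k wl k.
    apply/ler_addgt0Pr => e egt0; have W0 : 0 <= \sum_k wl k by exact: sumr_ge0.
    have W1 : 0 < \sum_k wl k + 1 by lra.
    apply: le_trans (key (e / (\sum_k wl k + 1)) _) _; first exact: divr_gt0.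
    by rewrite lerD2l -mulrA ler_piMr ?(ltW egt0)// mulrC ler_pdivrMr// mul1r lerDl.
  move=> egt0.
  rewrite mulr_sumr -big_split /=.
  apply: (@ler_cvg_to _ U _ _ (fun n => v - n.+1%:R^-1)
     (fun n => \sum_k (w n k * f (tl k) + e * w n k))).
  - by rewrite -[X in _ --> X]subr0; apply: cvgB => //; exact: cvg_cst.
  - apply: cvg_sumr => k; apply: cvgD; apply: cvgM => //; exact: cvg_cst.
  - have : \forall n \near U, forall k, f (t n k) < f (tl k) + e.
      apply: filter_forall => k.
      exact: (usc_near_lt uf (fun n => ct n k) (htl k).1 (htl k).2 egt0).
    apply: filterS => n fn; apply: le_trans (obj n) _.
    apply: ler_sum => k _; rewrite [e * _]mulrC -mulrDr ler_wpM2l//.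
    exact/ltW/fn.
split.
- by move=> k; have [] := htl k.
- move=> k j; apply: (ler_cvg_to (cvg_cst 0) (hal' k j)).
  exact: filterE.
- move=> k; apply: (ler_cvg_to _ (hwl k)); last exact: (filterE _ (fun n => aw n k)).
  by apply: cvg_sumr.
- apply: (@ler_cvg_to _ U _ _ (fun n => \sum_k w n k + \sum_j r j)
   (fun n => lam ^+ 2 + n.+1%:R^-1 + 2 * \sum_j Num.sqrt
      (r j * (\sum_k a n k j * cospos (t n k) (x j) ^+ 2 + n.+1%:R^-1)))).
  + by apply: cvgD; [exact: cvg_sumr|exact: cvg_cst].
  + apply: cvgD; first by apply: cvgD; [exact: cvg_cst|].
    apply: cvgM; first exact: cvg_cst.
    apply: cvg_sumr => j.
    suff h : r j * (\sum_k a n k j * cospos (t n k) (x j) ^+ 2 + n.+1%:R^-1) @[n --> U]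
        --> r j * (\sum_k al' k j * cospos (tl k) (x j) ^+ 2 + 0).
      by apply: continuous_cvg h; exact: sqrt_continuous.
    apply: cvgM; first exact: cvg_cst.
    apply: cvgD => //; apply: cvg_sumr => k; apply: cvgM => //.
    by apply: cvgM.
  + by apply: filterE => n; have [] := fea n.
Qed.
End limit.

(** * The maximum of the finite-dimensional problem *)

Section maximum.
Context {R : realType} (f : R * R -> R) (lam : R) (N : nat).
Context (x : 'I_N -> R * R) (r : 'I_N -> R).
Hypotheses (uf : usc_on_circle f) (cx : forall j, circle (x j)) (r0 : forall j, 0 < r j).

Lemma feasible_le M e e' t w a : 0 <= e -> e <= e' ->
  @feasible R lam N x r M e t w a -> feasible lam x r e' t w a.
Proof.
move=> e0 ee' [ct a0 aw fea]; split => //; apply: le_trans fea _.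
apply: lerD; first by rewrite lerD2l.
rewrite ler_pM2l//; apply: ler_sum => j _; apply: ler_wsqrtr.
by rewrite ler_pM2l// lerD2l.
Qed.

(* The witness is [mu1] itself. *)
Lemma feasible_nonempty : exists t w a, @feasible R lam N x r (N + 2) 0 t w a.
Proof.
(* The two surplus points are arbitrary and receive no mass. *)
pose t (k : 'I_(N + 2)) := match fintype.split k with inl j => x j | inr _ => (1, 0) end.
pose a (k : 'I_(N + 2)) j : R :=
  match fintype.split k with inl i => (i == j)%:R * r j | inr _ => 0 end.
have tl j : t (lshift 2 j) = x j by rewrite /t (unsplitK (inl j)).
have al i j : a (lshift 2 i) j = (i == j)%:R * r j by rewrite /a (unsplitK (inl i)).
have ar i j : a (rshift N i) j = 0 by rewrite /a (unsplitK (inr i)).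
have sumd (F : 'I_N -> R) j : \sum_i (i == j)%:R * F i = F j.
  rewrite (bigD1 j)//= eqxx mul1r big1 ?addr0// => i ij.
  by rewrite (negPf ij) mul0r.
have suma (F : 'I_(N + 2) -> R) j : \sum_k a k j * F k = r j * F (lshift 2 j).
  rewrite big_split_ord /= [X in _ + X]big1 ?addr0 => [|k _]; last by rewrite ar mul0r.
  under eq_bigr do rewrite al -mulrA.
  by rewrite (sumd (fun i => r j * F (lshift 2 i))).
have cosx j : cospos (x j) (x j) ^+ 2 = 1.
  have := cx j; rewrite /circle/= /sqnorm => h.
  by rewrite /cospos /dotp -!expr2 h max_r// expr1n.
exists t, (fun k => \sum_j a k j), a; split => //.
- move=> k; rewrite /t; case: fintype.split => // _.
  by rewrite /circle/= /sqnorm/= expr1n expr0n addr0.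
- move=> k j; rewrite /a; case: fintype.split => // i.
  by rewrite mulr_ge0// ltW.
- rewrite exchange_big/=.
  have -> : \sum_j \sum_k a k j = \sum_j r j.
    apply: eq_bigr => j _; rewrite -[RHS]mulr1 -(suma (fun=> 1)).
    by under [RHS]eq_bigr do rewrite mulr1.
  have -> : \sum_j Num.sqrt (r j * (\sum_k a k j * cospos (t k) (x j) ^+ 2 + 0)) = \sum_j r j.
    apply: eq_bigr => j _; rewrite addr0 (suma (fun k => cospos (t k) (x j) ^+ 2)) tl cosx mulr1.
    by rewrite -expr2 sqrtr_sqr gtr0_norm.
  have := sqr_ge0 lam; lra.
Qed.

(** [feasible_limit] serves twice: it shows that the supremum of [S] is attained, and that a value
    approached under relaxed constraints lies in [S]. *)
Lemma feasible_maximum : exists t w a, @feasible R lam N x r (N + 2) 0 t w a /\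
  forall v : R, (forall e : R, 0 < e -> exists t' w' a', @feasible R lam N x r (N + 2) e t' w' a' /\
     v - e <= \sum_k w' k * f (t' k)) -> v <= \sum_k w k * f (t k).
Proof.
pose S := [set v : R | exists t w a, @feasible R lam N x r (N + 2) 0 t w a /\
  v <= \sum_k w k * f (t k)].
have [b fb] := usc_bounded_above uf.
have supS : has_sup S.
  split.
    have [t [w [a fea]]] := feasible_nonempty.
    by exists (\sum_k w k * f (t k)), t, w, a.
  (* The bound [b] may be negative while the mass is only bounded above, hence the maximum with
     0. *)
  exists (Num.max b 0 * (2 * (lam ^+ 2 + 1 + \sum_j r j) + N%:R)) => v [t [w [a [fea vle]]]].
  have m := feasible_mass cx r0 (_ : 0 <= 0 <= 1) fea.
  apply: le_trans vle _.
  apply: (@le_trans _ _ (\sum_k w k * Num.max b 0)); last first.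
    by rewrite -mulr_suml mulrC ler_wpM2l ?le_max ?lexx ?orbT// m// lexx ler01.
  have [ct a0 aw _] := fea.
  apply: ler_sum => k _; rewrite ler_wpM2l ?le_max ?fb//.
  by apply: le_trans (aw k); exact: sumr_ge0.
have inv0 (n : nat) : 0 < n.+1%:R^-1 :> R by rewrite invr_gt0 ltr0n.
have [|t [w [a [fea supf]]]] := @feasible_limit _ f lam N x r (N + 2) uf cx r0 (sup S).
  move=> n; have [v [t [w [a [fea vle]]]] vgt] := sup_adherent (inv0 n) supS.
  exists t, w, a; split; first by apply: feasible_le fea => //; exact: ltW.
  exact: le_trans (ltW vgt) vle.
exists t, w, a; split => // v H; apply: le_trans supf; apply: ub_le_sup; first by case: supS.
by apply: feasible_limit => // n; exact: H.
Qed.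

End maximum.

(** * Discretization of plans *)

Section partition.
Context {d : measure_display} {T : measurableType d} {R : realType}.
Context (mu : {measure set T -> \bar R}) (I : finType) (D : I -> set T).
Hypotheses (mD : forall i, measurable (D i)) (tD : trivIset setT D).

Lemma Rintegral_partition (F : T -> R) :
  mu.-integrable (\bigcup_i D i) (EFin \o F) ->
  \int[mu]_(y in \bigcup_i D i) F y = \sum_i \int[mu]_(y in D i) F y.
Proof.
have DE : \bigcup_i D i = \big[setU/set0]_(i <- index_enum I) D i.
  by rewrite -bigcup_seq; congr bigcup; apply/seteqP; split=> // i _; rewrite /= mem_index_enum.
move=> iF; rewrite /Rintegral DE integral_bigsetU_EFin//.
- rewrite sum_fine// => i _; apply: integrable_fin_num => //.
  apply: integrableS iF => //; last exact: bigcup_sup.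
  by rewrite DE; exact: bigsetU_measurable.
- exact: index_enum_uniq.
- exact: sub_trivIset tD.
- by rewrite -DE; exact: measurable_int iF.
Qed.

End partition.

(** * Grid on the circle and pointwise cost bound *)

Section cells.
Context {R : realType}.

(* Half-open squares of side [1 / n], in the coordinates [n (p + 1)]. *)
Lemma circle_partition (e : R) : 0 < e ->
  exists (I : finType) (C : I -> set (R * R)),
    [/\ forall i, measurable (C i), trivIset setT C, \bigcup_i C i = circle (R:=R)
      & forall i p q, C i p -> C i q -> `|p.1 - q.1| <= e /\ `|p.2 - q.2| <= e].
Proof.
move=> e0; pose n := (Num.truncn e^-1).+1.
have ne : e^-1 < n%:R by exact: truncnS_gt.
have n0 : 0 < n%:R :> R by rewrite ltr0n.
have ne1 : n%:R^-1 < e by rewrite -[ltRHS]invrK ltf_pV2// posrE invr_gt0.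
pose cell (i : nat) : set R := [set y | i%:R <= n%:R * (y + 1) < i.+1%:R].
(* The coordinate [n * (y + 1)] takes the value [2 * n] at [y = 1], which needs one more half-open
   cell. *)
pose m := (2 * n).+1.
pose C (i : 'I_m * 'I_m) : set (R * R) := circle (R:=R) `&` (cell i.1 `*` cell i.2).
have mcell i : measurable (cell i).
  rewrite (_ : cell i = `[i%:R / n%:R - 1, i.+1%:R / n%:R - 1[%classic).
    exact: measurable_itv.
  apply/seteqP; split => y /=; rewrite in_itv/= lerBlDr ltrBrDr.
    by rewrite ler_pdivrMr// ltr_pdivlMr// mulrC.
  by rewrite ler_pdivrMr// ltr_pdivlMr// mulrC.
have cell_inj i j y : cell i y -> cell j y -> i = j.
  move=> /andP[i1 i2] /andP[j1 j2].
  have := le_lt_trans i1 j2; have := le_lt_trans j1 i2.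
  by rewrite !ltr_nat !ltnS => ji ij; apply/eqP; rewrite eqn_leq ij ji.
have cell_near i y z : cell i y -> cell i z -> `|y - z| <= e.
  move=> /andP[y1 y2] /andP[z1 z2].
  apply: ltW; apply: lt_trans ne1; rewrite -[ltRHS]mul1r ltr_pdivlMr//.
  rewrite -[X in _ * X]gtr0_norm// -normrM ltr_norml.
  by move: y2 z2; rewrite -natr1 => y2 z2; apply/andP; split; lra.
have cell_cover y : `|y| <= 1 -> exists i : 'I_m, cell i y.
  rewrite ler_norml => /andP[y1 y2].
  have ny : 0 <= n%:R * (y + 1) by rewrite mulr_ge0//; lra.
  have := truncn_itv ny => /andP[t1 t2].
  have ti : (Num.truncn (n%:R * (y + 1))%R < m)%N.
    rewrite ltnS -(ler_nat R); apply: le_trans t1 _; rewrite natrM; nra.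
  by exists (Ordinal ti); apply/andP.
exists ('I_m * 'I_m)%type, C; split.
- move=> i; apply: measurableI; first exact: measurable_circle.
  exact: measurableX.
- move=> [i1 i2] [j1 j2] _ _ [p [[_ [/= p1 p2]] [_ [/= q1 q2]]]].
  by congr pair; apply: val_inj; [exact: cell_inj p1 q1|exact: cell_inj p2 q2].
- apply/seteqP; split => [p [i _ []]//|p cp].
  have [p1 p2] := circle_norm_le1 cp.
  have [i1 h1] := cell_cover _ p1; have [i2 h2] := cell_cover _ p2.
  by exists (i1, i2).
- move=> i p q [_ [p1 p2]] [_ [q1 q2]].
  by split; [exact: cell_near p1 q1|exact: cell_near p2 q2].
Qed.

(** [cospos] increases by at most [2 * e], and the two values add up to at most 2. *)
Lemma cospos2_near (p q y : R * R) (e : R) : circle p -> circle q -> circle y ->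
  `|p.1 - q.1| <= e -> `|p.2 - q.2| <= e -> cospos p y ^+ 2 <= cospos q y ^+ 2 + 4 * e.
Proof.
move=> cp cq cy h1 h2.
have cos1 (u : R * R) : circle u -> cospos u y <= 1.
  by move=> cu; rewrite /cospos ge_max ler01 dotp_le1.
have [y1 y2] := circle_norm_le1 cy.
have e0 : 0 <= e by apply: le_trans h1.
have : dotp p y <= dotp q y + 2 * e.
  rewrite -lerBlDl /dotp.
  rewrite (_ : _ - _ = (p.1 - q.1) * y.1 + (p.2 - q.2) * y.2); last by ring.
  apply: le_trans (ler_norm _) _; apply: le_trans (ler_normD _ _) _.
  rewrite !normrM (_ : 2 * e = e * 1 + e * 1); last by ring.
  by apply: lerD; apply: ler_pM.
move=> h; have hc : cospos p y <= cospos q y + 2 * e.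
  rewrite {1}/cospos ge_max addr_ge0 ?cospos_ge0 ?mulr_ge0//=.
  by apply: le_trans h _; rewrite lerD2r /cospos le_max lexx orbT.
have := cos1 _ cp; have := cos1 _ cq; have := cospos_ge0 p y; have := cospos_ge0 q y.
nra.
Qed.

(* Cauchy-Schwarz in parametric form: optimizing [tau] after integration avoids an
   [L^2] inequality for [g]. *)
Lemma sqdist_amgm (z : (R * R) * (R * R)) (tau kap : R) : 0 < tau ->
  cospos (theta z.1) (theta z.2) ^+ 2 <= kap ->
  sqnorm z.1 + sqnorm z.2 <= sqdist z.1 z.2 + tau * kap * sqnorm z.1 + tau^-1 * sqnorm z.2.
Proof.
move=> tau0 hk; set c := cospos _ _ in hk.
set s := Num.sqrt (sqnorm z.1); set u := Num.sqrt (sqnorm z.2).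
have s2 : sqnorm z.1 = s ^+ 2 by rewrite sqr_sqrtr ?sqnorm_ge0.
have u2 : sqnorm z.2 = u ^+ 2 by rewrite sqr_sqrtr ?sqnorm_ge0.
have -> : sqdist z.1 z.2 = s ^+ 2 + u ^+ 2 - 2 * (s * u * dotp (theta z.1) (theta z.2)).
  rewrite [in LHS](polar_decomposition z.1) [in LHS](polar_decomposition z.2).
  by rewrite sqdist_scalep//; exact: theta_circle.
have s0 : 0 <= s by exact: sqrtr_ge0. have u0 : 0 <= u by exact: sqrtr_ge0.
have dc : s * u * dotp (theta z.1) (theta z.2) <= s * u * c.
  by rewrite ler_wpM2l ?mulr_ge0// /c /cospos le_max lexx orbT.
rewrite s2 u2.
have h1 : 2 * (s * u * c) <= tau * c ^+ 2 * s ^+ 2 + tau^-1 * u ^+ 2.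
  rewrite -subr_ge0 (_ : _ - _ = tau * (c * s - tau^-1 * u) ^+ 2).
    by rewrite mulr_ge0 ?sqr_ge0// ltW.
  by field; rewrite gt_eqF.
have h2 : tau * c ^+ 2 * s ^+ 2 <= tau * kap * s ^+ 2.
  by rewrite ler_wpM2r ?sqr_ge0// ler_wpM2l// ltW.
lra.
Qed.

End cells.

(** * Almost optimal plans and integrability *)

Section ball.
Context {R : realType}.
Implicit Types mu nu : {measure set (R * R)%type -> \bar R}.

Lemma WFR_ball_plan (lam e : R) mu1 nu : 0 <= lam -> 0 < e -> WFR_ball lam mu1 nu ->
  exists g, is_plan nu mu1 g /\
    exists2 c : R, (\int[g]_z (sqdist z.1 z.2)%:E = c%:E)%E & c <= lam ^+ 2 + e.
Proof.
move=> lam0 e0 [_ Wle].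
(* As [eta <= 1], the square of [lam + eta] exceeds [lam ^+ 2] by at most
   [eta * (2 * lam + 1) <= e]. *)
pose eta := Num.min 1 (e / (2 * lam + 1)).
have l1 : 0 < 2 * lam + 1 by lra.
have eta0 : 0 < eta by rewrite /eta lt_min ltr01 divr_gt0.
have eta1 : eta <= 1 by rewrite /eta ge_min lexx.
have eta2 : eta * (2 * lam + 1) <= e by rewrite -ler_pdivlMr// /eta ge_min lexx orbT.
have /ereal_inf_lt[_ [g [gplan ->]]] : (WFR nu mu1 < (lam + eta)%:E)%E.
  by apply: le_lt_trans Wle _; rewrite lte_fin ltrDl.
have : (0 <= \int[g]_z (sqdist z.1 z.2)%:E)%E.
  by apply: integral_ge0 => z _; rewrite lee_fin sqdist_ge0.
case cE : (\int[g]_z (sqdist z.1 z.2)%:E)%E => [c||]//=.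
rewrite lee_fin lte_fin => c0 clt; exists g; split => //; exists c => //.
have : Num.sqrt c ^+ 2 <= (lam + eta) ^+ 2 by rewrite lerXn2r ?nnegrE ?sqrtr_ge0 ?ltW//; lra.
by rewrite sqr_sqrtr//; nra.
Qed.

(** The positive part is bounded and the mass finite; an infinite negative part would then make the
    integral -oo, below [s]. *)
Lemma integrable_usc (f : R * R -> R) nu (s : R) : usc_on_circle f -> Mplus nu ->
  (s%:E <= int_circle f nu)%E -> nu.-integrable (@circle R) (EFin \o f).
Proof.
move=> uf [nufin _] sle; have mc := @measurable_circle R.
have mf : measurable_fun (@circle R) (EFin \o f).
  by apply/measurable_EFinP; exact: measurable_usc.
have mfp := measurable_funepos mf; have mfn := measurable_funeneg mf.
have [b fb] := usc_bounded_above uf.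
have pfin : (\int[nu]_(y in @circle R) (EFin \o f)^\+ y < +oo)%E.
  apply: (@le_lt_trans _ _ (\int[nu]_(y in @circle R) (cst (Num.max b 0)%:E y)))%E.
    apply: ge0_le_integral => //.
    move=> y cy; rewrite funeposE -EFin_max lee_fin.
    by rewrite ge_max !le_max fb//= lexx orbT.
  rewrite integral_cst//; apply: lte_mul_pinfty => //; first by rewrite lee_fin le_max lexx orbT.
  apply: le_lt_trans nufin; apply: le_measure => //; rewrite inE//.
have nfin : (\int[nu]_(y in @circle R) (EFin \o f)^\- y < +oo)%E.
  rewrite ltey; apply/eqP => nE; move: sle.
  rewrite /int_circle integralE nE.
  by move: pfin; case: (\int[nu]_(y in _) (EFin \o f)^\+ y)%E.
apply/integrableP; split => //.
rewrite -[fun y => _]/(abse \o (EFin \o f)) fune_abse.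
by rewrite ge0_integralD//; exact: lte_add_pinfty.
Qed.

End ball.

(** * Restriction of a plan to pieces *)

Section pieces.
Context {R : realType} (mu0 mu1 : {measure set (R * R)%type -> \bar R}).
Context (g : {measure set ((R * R) * (R * R))%type -> \bar R}).
Hypothesis plan : is_plan mu0 mu1 g.

Lemma integrable_sqnorm1 : g.-integrable setT (EFin \o (fun z => sqnorm z.1)).
Proof.
have [fin _] := plan; apply/integrableP; split.
  by apply/measurable_EFinP; exact: measurable_fst_sqnorm.
apply: le_lt_trans fin; apply: ge0_le_integral => //.
- by apply: measurableT_comp => //; apply/measurable_EFinP; exact: measurable_fst_sqnorm.
- apply/measurable_EFinP; apply: measurable_funD;
    [exact: measurable_fst_sqnorm|exact: measurable_snd_sqnorm].
- by move=> z _ /=; rewrite lee_fin ger0_norm ?sqnorm_ge0// lerDl sqnorm_ge0.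
Qed.

Lemma integrable_sqnorm2 : g.-integrable setT (EFin \o (fun z => sqnorm z.2)).
Proof.
have [fin _] := plan; apply/integrableP; split.
  by apply/measurable_EFinP; exact: measurable_snd_sqnorm.
apply: le_lt_trans fin; apply: ge0_le_integral => //.
- by apply: measurableT_comp => //; apply/measurable_EFinP; exact: measurable_snd_sqnorm.
- apply/measurable_EFinP; apply: measurable_funD;
    [exact: measurable_fst_sqnorm|exact: measurable_snd_sqnorm].
- by move=> z _ /=; rewrite lee_fin ger0_norm ?sqnorm_ge0// lerDr sqnorm_ge0.
Qed.

Lemma integrable_sqdist (c : R) : (\int[g]_z (sqdist z.1 z.2)%:E = c%:E)%E ->
  g.-integrable setT (EFin \o (fun z => sqdist z.1 z.2)).
Proof.
move=> cE; apply/integrableP; split; first by apply/measurable_EFinP; exact: measurable_sqdist.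
rewrite (_ : (fun z => _) = fun z => (sqdist z.1 z.2)%:E) ?cE ?ltry//.
by apply/funext => z /=; rewrite ger0_norm ?sqdist_ge0.
Qed.

Lemma plan_marginal1 A : measurable A ->
  fine (mu0 A) = \int[g]_(z in (fun z => theta z.1) @^-1` A) sqnorm z.1.
Proof. by move=> mA; have [_ [-> //]] := plan. Qed.

Lemma plan_marginal2 A : measurable A ->
  fine (mu1 A) = \int[g]_(z in (fun z => theta z.2) @^-1` A) sqnorm z.2.
Proof. by move=> mA; have [_ [_ -> //]] := plan. Qed.

Lemma Rintegral_amgm (D : set ((R * R) * (R * R))) (c tau kap : R) :
  (\int[g]_z (sqdist z.1 z.2)%:E = c%:E)%E -> measurable D -> 0 < tau ->
  (forall z, D z -> cospos (theta z.1) (theta z.2) ^+ 2 <= kap) ->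
  \int[g]_(z in D) sqnorm z.1 + \int[g]_(z in D) sqnorm z.2 <=
  \int[g]_(z in D) sqdist z.1 z.2 + tau * kap * \int[g]_(z in D) sqnorm z.1
   + tau^-1 * \int[g]_(z in D) sqnorm z.2.
Proof.
move=> cE mD tau0 hk.
have iD F : g.-integrable setT (EFin \o F) -> g.-integrable D (EFin \o F).
  by apply: integrableS.
have i1 := iD _ integrable_sqnorm1; have i2 := iD _ integrable_sqnorm2.
have ic := iD _ (integrable_sqdist cE).
have iZ k F : g.-integrable D (EFin \o F) -> g.-integrable D (EFin \o (fun z => k * F z)).
  by move=> iF; exact: (integrableZl mD k iF).
have iA F G : g.-integrable D (EFin \o F) -> g.-integrable D (EFin \o G) ->
    g.-integrable D (EFin \o (fun z => F z + G z)).
  by move=> iF iG; exact: (integrableD mD iF iG).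
have j1 := iZ (tau * kap) _ i1; have j2 := iZ tau^-1 _ i2.
rewrite -(RintegralD mD i1 i2) -(RintegralZl _ mD i1) -(RintegralZl _ mD i2).
rewrite -(RintegralD mD ic j1) -(RintegralD mD (iA _ _ ic j1) j2).
apply: le_Rintegral => //; [exact: iA|exact: iA (iA _ _ ic j1) j2|].
by move=> z Dz; apply: sqdist_amgm => //; exact: hk.
Qed.

End pieces.

(** * Reduction to N + 2 atoms *)

Section atoms.
Context {R : realType} (f : R * R -> R) (lam : R) (N : nat).
Context (x : 'I_N -> R * R) (r : 'I_N -> R).

(** [al (i, Some j)] is the mass at [t i] sent to [x j], and [al (i, None)] the mass destroyed
    there. The bound and the objective depend on [al] only through N + 2 linear functionals, which
    the conic reduction preserves. *)
Lemma feasible_of_atoms (I : finType) (i0 : I) (t : I -> R * R)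
    (al : I * option 'I_N -> R) (e : R) :
  (forall i, circle (t i)) -> (forall k, 0 <= al k) ->
  \sum_k al k + \sum_j r j <= lam ^+ 2 + e
    + 2 * \sum_j Num.sqrt (r j * (\sum_i al (i, Some j) * cospos (t i) (x j) ^+ 2 + e)) ->
  exists t' w a, @feasible R lam N x r (N + 2) e t' w a /\
    \sum_k w k * f (t' k) = \sum_k al k * f (t k.1).
Proof.
move=> ct al0 hle.
(* The first N coordinates yield the [Q_j], the last two the mass and the objective. *)
pose v (k : I * option 'I_N) : 'rV[R]_(N + 2) := \row_c
  match fintype.split c with
  | inl j => (k.2 == Some j)%:R * cospos (t k.1) (x j) ^+ 2
  | inr b => if b == ord0 then 1 else f (t k.1)
  end.
have vl k j : v k 0 (lshift 2 j) = (k.2 == Some j)%:R * cospos (t k.1) (x j) ^+ 2.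
  by rewrite mxE (unsplitK (inl j)).
have vr0 k : v k 0 (rshift N ord0) = 1 by rewrite mxE (unsplitK (inr ord0)).
have vr1 k : v k 0 (rshift N (lift ord0 ord0)) = f (t k.1).
  by rewrite mxE (unsplitK (inr (lift ord0 ord0))).
have [s [u [u0 uv]]] := conic_caratheodory_ord (i0, None) v al0.
have uvc c : \sum_k u k * v (s k) 0 c = \sum_k al k * v k 0 c.
  have := congr1 (fun y : 'rV[R]_(N + 2) => y 0 c) uv.
  rewrite !summxE; under eq_bigr do rewrite mxE.
  by under [X in _ = X -> _]eq_bigr do rewrite mxE.
have mass : \sum_k u k = \sum_k al k.
  have := uvc (rshift N ord0).
  under eq_bigr do rewrite vr0 mulr1.
  by under [X in _ = X -> _]eq_bigr do rewrite vr0 mulr1.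
have obj : \sum_k u k * f (t (s k).1) = \sum_k al k * f (t k.1).
  have := uvc (rshift N (lift ord0 ord0)).
  under eq_bigr do rewrite vr1.
  by under [X in _ = X -> _]eq_bigr do rewrite vr1.
(* Each selected atom has a single label, so all its mass goes to one [x j] or is destroyed. *)
exists (t \o fst \o s), u, (fun k j => u k * ((s k).2 == Some j)%:R); split => //.
split => //=.
- by move=> k j; rewrite mulr_ge0.
- move=> k; rewrite -mulr_sumr ler_piMr//.
  case: ((s k).2) => [j|]; last by rewrite big1.
  rewrite (bigD1 j)//= eqxx big1 ?addr0// => i ij.
  by case: eqP => // -[ji]; rewrite ji eqxx in ij.
- rewrite mass; apply: le_trans hle _; rewrite lerD2l ler_pM2l//.
  apply: ler_sum => j _; apply: ler_wsqrtr; rewrite le_eqVlt; apply/orP; left; apply/eqP.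
  congr (_ * (_ + _)); transitivity (\sum_k al k * v k 0 (lshift 2 j)).
    transitivity (\sum_i \sum_l al (i, l) * ((l == Some j)%:R * cospos (t i) (x j) ^+ 2)).
      apply: eq_bigr => i _; rewrite (bigD1 (Some j))//= eqxx mul1r big1 ?addr0// => l lj.
      by rewrite (negPf lj) mul0r mulr0.
    by rewrite pair_bigA; apply: eq_bigr => -[i l] _; rewrite vl.
  by rewrite -uvc; apply: eq_bigr => k _; rewrite vl mulrA.
Qed.

End atoms.

(** * From a measure in the ball to relaxed configurations *)

Section discretization.
Context {R : realType} (f : R * R -> R) (lam : R) (N : nat).
Context (x : 'I_N -> R * R) (r : 'I_N -> R).
Context (mu1 nu : {measure set (R * R)%type -> \bar R}).
Hypotheses (uf : usc_on_circle f) (lam0 : 0 <= lam).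
Hypotheses (cx : forall j, circle (x j)) (inj_x : injective x) (r0 : forall j, 0 < r j).
Hypotheses (mu1E : is_discrete_measure mu1 x r) (nuball : WFR_ball lam mu1 nu).

(** Classes of second directions: one for each atom of [mu1], and [None] for the rest, which [mu1]
    does not charge. *)
Definition label (l : option 'I_N) : set (R * R) :=
  if l is Some j then [set x j] else [set y | forall j, y <> x j].

Lemma measurable_label l : measurable (label l).
Proof.
case: l => [j|]; first exact: measurable_point.
rewrite (_ : label None = ~` \bigcup_(j in setT) [set x j]).
  by apply: measurableC; apply: fin_bigcup_measurable => // j _; exact: measurable_point.
apply/seteqP; split => y /= h; first by move=> [j _ /= /h].
by move=> j yj; apply: h; exists j.
Qed.

Lemma trivIset_label : trivIset setT label.
Proof.
move=> [i|] [j|] _ _ [y [/= h1 h2]] => //.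
- by congr Some; apply: inj_x; rewrite -h1.
- by case: (h2 i).
- by case: (h1 j).
Qed.

Lemma bigcup_label : \bigcup_l label l = setT.
Proof.
apply/seteqP; split => // y _.
have [[j yj]|h] := pselect (exists j, y = x j); first by exists (Some j).
by exists None => // j yj; apply: h; exists j.
Qed.

Lemma mu1_label l : fine (mu1 (label l)) = if l is Some j then r j else 0.
Proof.
rewrite mu1E; last exact: measurable_label.
under eq_bigr do rewrite diracE -EFinM.
rewrite sumEFin /=; case: l => [j|] /=.
  rewrite (bigD1 j)//= mem_set// mulr1 big1 ?addr0// => i ij.
  by rewrite memNset ?mulr0// => /= /inj_x /eqP; rewrite (negPf ij).
by rewrite big1// => j _; rewrite memNset ?mulr0// => /(_ j).
Qed.

Lemma sum_option (G : option 'I_N -> R) : \sum_l G l = G None + \sum_j G (Some j).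
Proof.
rewrite (bigD1 None)//=; congr (_ + _).
by rewrite (reindex_omap Some id) => [|[j|]//]; apply: eq_bigl => j; rewrite eqxx.
Qed.

(** The minimum over [tau] of [tau * y + z / tau]; it turns the parametric inequality back into
    Cauchy-Schwarz. *)
Lemma optimal_tau (y z : R) : 0 < y -> 0 < z ->
  Num.sqrt (z / y) * y + (Num.sqrt (z / y))^-1 * z = 2 * Num.sqrt (z * y).
Proof.
move=> y0 z0; rewrite !sqrtrM ?ltW// sqrtrV ?ltW//.
rewrite -{2}(sqr_sqrtr (ltW y0)) -{3}(sqr_sqrtr (ltW z0)).
have : 0 < Num.sqrt y by rewrite sqrtr_gt0.
have : 0 < Num.sqrt z by rewrite sqrtr_gt0.
by move=> a0 b0; field; rewrite !gt_eqF.
Qed.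

(** A cell need not be closed, so [f] may not attain its supremum there and a point within [e1] is
    taken. An empty cell gets an arbitrary point. *)
Lemma approx_argmax (C : set (R * R)) (d e1 : R) : 0 < d -> 0 < e1 -> C `<=` circle (R:=R) ->
  (forall p q, C p -> C q -> `|p.1 - q.1| <= d /\ `|p.2 - q.2| <= d) ->
  exists p, circle p /\ forall q, C q -> f q <= f p + e1 /\
    forall y, circle y -> cospos q y ^+ 2 <= cospos p y ^+ 2 + 4 * d.
Proof.
move=> d0 e10 Cc Cd; have [[p0 Cp0]|C0] := pselect (exists p, C p); last first.
  exists (1, 0); split; first by rewrite /circle/= /sqnorm/= expr1n expr0n addr0.
  by move=> q Cq; exfalso; apply: C0; exists q.
have [b fb] := usc_bounded_above uf.
have supC : has_sup (f @` C).
  by split; [exists (f p0), p0|exists b => _ [q Cq <-]; exact/fb/Cc].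
have [_ [p Cp <-] pgt] := sup_adherent e10 supC.
exists p; split; first exact: Cc; move=> q Cq; split.
  rewrite -lerBlDr; apply: le_trans (ltW pgt); rewrite lerD2r.
  by apply: ub_le_sup; [case: supC|exists q].
by move=> y cy; have [h1 h2] := Cd _ _ Cq Cp; apply: cospos2_near => //; exact: Cc.
Qed.

(** An almost optimal plan is cut by the cell of the first direction and the label of the second;
    the mass of cell [i] moves to [t i], and the parametric inequality is summed over the pieces. *)
Lemma feasible_of_ball (s e : R) : 0 < e -> (s%:E <= int_circle f nu)%E ->
  exists t w a, @feasible R lam N x r (N + 2) e t w a /\ s - e <= \sum_k w k * f (t k).
Proof.
move=> e0 sle; have e2 : 0 < e / 2 by lra.
have [g [plan [c cE cle]]] := WFR_ball_plan lam0 e2 nuball.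
have fint := integrable_usc uf (proj1 nuball) sle.
pose m := fine (nu setT); have m0 : 0 <= m by exact: fine_ge0.
have m1 : 0 < m + 1 by lra.
(* The grid errors will be [4 * d * m <= e]; adding 1 to [m] covers zero mass. *)
pose d := e / 4 / (m + 1); have d0 : 0 < d by rewrite divr_gt0//; lra.
have dm : d * m <= e / 4 by rewrite /d -mulrA ler_piMr ?ler_pdivrMl//; lra.
have [I [C [mC tC CE nearC]]] := circle_partition d0.
have Cc i : C i `<=` circle (R:=R) by rewrite -CE; exact: bigcup_sup.
have e10 : 0 < 4 * d by lra.
have /choice[t ht] := fun i => approx_argmax d0 e10 (Cc i) (nearC i).
have ct i : circle (t i) by have [] := ht i.
pose B (k : I * option 'I_N) : set ((R * R) * (R * R)) :=
  ((fun z => theta z.1) @^-1` C k.1) `&` ((fun z => theta z.2) @^-1` label k.2).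
have mB k : measurable (B k).
  apply: measurableI; first exact: measurable_theta1.
  by apply: measurable_theta2; exact: measurable_label.
have tB : trivIset setT B.
  move=> [i l] [i' l'] _ _ [z [[/= z1 z2] [/= z3 z4]]].
  by congr pair; [apply: tC => //; exists (theta z.1)|
    apply: trivIset_label => //; exists (theta z.2)].
have BE : \bigcup_k B k = setT.
  apply/seteqP; split => // z _.
  have [i _ zi] : (\bigcup_i C i) (theta z.1) by rewrite CE; exact: theta_circle.
  have [l _ zl] : (\bigcup_l label l) (theta z.2) by rewrite bigcup_label.
  by exists (i, l).
have BlE l : \bigcup_i B (i, l) = (fun z => theta z.2) @^-1` label l.
  apply/seteqP; split => [z [i _ []]//|z zl].
  have [i _ zi] : (\bigcup_i C i) (theta z.1) by rewrite CE; exact: theta_circle.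
  by exists i.
have BiE i : \bigcup_l B (i, l) = (fun z => theta z.1) @^-1` C i.
  apply/seteqP; split => [z [l _ []]//|z zi].
  have [l _ zl] : (\bigcup_l label l) (theta z.2) by rewrite bigcup_label.
  by exists l.
have i1 := integrable_sqnorm1 plan; have i2 := integrable_sqnorm2 plan.
have ic := integrable_sqdist cE.
(* On each piece: the mass of [nu] that leaves, the mass of [mu1] that arrives, and the cost. *)
pose al k := \int[g]_(z in B k) sqnorm z.1.
pose be k := \int[g]_(z in B k) sqnorm z.2.
pose ga k := \int[g]_(z in B k) sqdist z.1 z.2.
have al0 k : 0 <= al k by apply: Rintegral_ge0 => z _; exact: sqnorm_ge0.
have sum_al i : \sum_l al (i, l) = fine (nu (C i)).
  rewrite (plan_marginal1 plan (mC i)) -BiE Rintegral_partition//.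
  - by move=> l l' _ _ /(tB (i, l) (i, l') Logic.I Logic.I)[].
  - by apply: integrableS i1 => //; rewrite BiE; exact: measurable_theta1.
have sum_be l : \sum_i be (i, l) = if l is Some j then r j else 0.
  rewrite -mu1_label (plan_marginal2 plan (measurable_label l)) -BlE Rintegral_partition//.
  - by move=> i i' _ _ /(tB (i, l) (i', l) Logic.I Logic.I)[].
  - by apply: integrableS i2 => //; rewrite BlE; apply: measurable_theta2; exact: measurable_label.
have sum_B F : g.-integrable setT (EFin \o F) ->
    \sum_k \int[g]_(z in B k) F z = \int[g]_z F z.
  by move=> iF; rewrite -BE Rintegral_partition// BE.
have sumE (G : I * option 'I_N -> R) :
    \sum_k G k = \sum_i G (i, None) + \sum_j \sum_i G (i, Some j).
  transitivity (\sum_l \sum_i G (i, l)); last by rewrite sum_option.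
  by rewrite exchange_big pair_bigA; apply: eq_bigr => -[].
have al_m : \sum_k al k = m by rewrite sum_B// /m (plan_marginal1 plan)// preimage_setT.
have be_r : \sum_k be k = \sum_j r j.
  by rewrite sumE sum_be add0r; apply: eq_bigr => j _; rewrite sum_be.
have ga_c : \sum_k ga k = c by rewrite sum_B// /Rintegral cE.
pose Q j := \sum_i al (i, Some j) * cospos (t i) (x j) ^+ 2.
have Q0 j : 0 <= Q j by apply: sumr_ge0 => i _; rewrite mulr_ge0// sqr_ge0.
have Qe j : 0 < Q j + e by have := Q0 j; lra.
(* Optimal for each atom, where adding [e] keeps the denominator positive. For [None] no mass
   arrives, so a small [tau] is harmless. *)
pose tau (l : option 'I_N) := if l is Some j then Num.sqrt (r j / (Q j + e)) else 2 * d.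
have tau0 l : 0 < tau l.
  by case: l => [j|] /=; [rewrite sqrtr_gt0 divr_gt0|lra].
pose kap (k : I * option 'I_N) :=
  if k.2 is Some j then cospos (t k.1) (x j) ^+ 2 + 4 * d else 1.
have ineq k : al k + be k <= ga k + tau k.2 * kap k * al k + (tau k.2)^-1 * be k.
  apply: (Rintegral_amgm plan cE) => // z [z1 z2].
  have [_ /(_ _ z1)[_ near]] := ht k.1.
  case: k z1 z2 near => i [j|] /= z1 z2 near; last by apply: cospos2_le1; exact: theta_circle.
  by rewrite z2; exact: near.
(* Half of the outer [e] pays for the almost optimal plan and half for the label [None]; the [e]
   under the root absorbs the grid error in [kap]. *)
have tot : m + \sum_j r j <= lam ^+ 2 + e + 2 * \sum_j Num.sqrt (r j * (Q j + e)).
  have : \sum_k (al k + be k) <= \sum_k (ga k + tau k.2 * kap k * al k + (tau k.2)^-1 * be k).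
    exact: ler_sum.
  rewrite !big_split/= al_m be_r ga_c => h; apply: le_trans h _.
  have aln : \sum_i al (i, None) <= m.
    rewrite -al_m sumE lerDl; apply: sumr_ge0 => j _; exact: sumr_ge0.
  have alj j : \sum_i al (i, Some j) <= m.
    rewrite -al_m sumE (bigD1 j)//= addrCA lerDl.
    by apply: addr_ge0; apply: sumr_ge0 => // j' _; exact: sumr_ge0.
  have -> : \sum_k tau k.2 * kap k * al k = 2 * d * \sum_i al (i, None) +
      \sum_j \sum_i tau (Some j) * kap (i, Some j) * al (i, Some j).
    rewrite sumE; congr (_ + _); rewrite mulr_sumr.
    by apply: eq_bigr => i _; rewrite /kap/= mulr1.
  have -> : \sum_k (tau k.2)^-1 * be k = \sum_j (tau (Some j))^-1 * r j.
    rewrite sumE /= -mulr_sumr sum_be mulr0 add0r.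
    by apply: eq_bigr => j _; rewrite -mulr_sumr sum_be.
  have tj j : \sum_i tau (Some j) * kap (i, Some j) * al (i, Some j) <=
      tau (Some j) * (Q j + e).
    under eq_bigr do rewrite -mulrA.
    rewrite -mulr_sumr ler_pM2l//.
    under eq_bigr do rewrite /kap/= mulrDl [_ * al _]mulrC.
    rewrite big_split/= -/(Q j) lerD2l -mulr_sumr.
    by have := alj j; nra.
  have : \sum_j \sum_i tau (Some j) * kap (i, Some j) * al (i, Some j) +
       \sum_j (tau (Some j))^-1 * r j <= 2 * \sum_j Num.sqrt (r j * (Q j + e)).
    rewrite -big_split/= mulr_sumr; apply: ler_sum => j _.
    by rewrite -optimal_tau// lerD2r; exact: tj.
  have : 2 * d * \sum_i al (i, None) <= e / 2 by nra.
  by lra.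
have inh : exists i0 : I, True.
  have : (\bigcup_i C i) (theta (0, 0)) by rewrite CE; exact: theta_circle.
  by case=> i0 _ _; exists i0.
case: inh => i0 _.
rewrite -al_m in tot.
have [t' [w [a [fea obj]]]] := feasible_of_atoms f i0 ct al0 tot.
exists t', w, a; split => //; rewrite obj.
have -> : \sum_k al k * f (t k.1) = \sum_i fine (nu (C i)) * f (t i).
  transitivity (\sum_i \sum_l al (i, l) * f (t i)).
    by rewrite pair_bigA; apply: eq_bigr => -[].
  by apply: eq_bigr => i _; rewrite -sum_al mulr_suml.
have sle' : s <= \int[nu]_(y in circle (R:=R)) f y.
  by rewrite -lee_fin /Rintegral fineK//; exact: (integrable_fin_num measurable_circle fint).
have nufin A : measurable A -> (nu A < +oo)%E.
  move=> mA; have [[nT _] _] := nuball; apply: le_lt_trans nT.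
  by apply: le_measure => //; rewrite inE.
have intC i : nu.-integrable (C i) (EFin \o f).
  by apply: integrableS fint => //; exact: measurable_circle.
(* The choice of [t i] loses at most [4 * d] on its cell, in total [4 * d * m <= e]. *)
have up : \int[nu]_(y in circle (R:=R)) f y <= \sum_i fine (nu (C i)) * (f (t i) + 4 * d).
  rewrite -CE Rintegral_partition// ?CE//; apply: ler_sum => i _.
  rewrite mulrC -Rintegral_cst//; apply: le_Rintegral => //.
    apply: measurable_bounded_integrable => //; first exact: nufin.
    by exists `|f (t i) + 4 * d|; split => // M' hM' y _ /=; exact: ltW.
  by move=> y Cy; have [_ /(_ _ Cy)[]] := ht i.
have mC' : \sum_i fine (nu (C i)) = m.
  by rewrite -al_m; under eq_bigr do rewrite -sum_al; rewrite pair_bigA; apply: eq_bigr => -[].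
have : \sum_i fine (nu (C i)) * (f (t i) + 4 * d) = \sum_i fine (nu (C i)) * f (t i) + m * (4 * d).
  by under eq_bigr do rewrite mulrDr; rewrite big_split/= -mulr_suml mC'.
by move: sle' up dm; nra.
Qed.

End discretization.

Theorem theorem4p3 (R : realType) (f : R * R -> R) (lam : R) (N : nat)
    (x : 'I_N -> R * R) (r : 'I_N -> R)
    (mu1 : {measure set (R * R)%type -> \bar R}) :
  usc_on_circle f ->
  0 <= lam ->
  (forall j, circle (x j)) ->
  injective x ->
  (forall j, 0 < r j) ->
  is_discrete_measure mu1 x r ->
  exists mu0 : {measure set (R * R)%type -> \bar R},
    [/\ WFR_ball lam mu1 mu0,
        (exists (M : nat) (p : 'I_M -> R * R) (w : 'I_M -> R),
           [/\ (M <= N + 2)%N, (forall k, circle (p k)), (forall k, 0 <= w k)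
             & is_discrete_measure mu0 p w])
      & forall nu : {measure set (R * R)%type -> \bar R},
          WFR_ball lam mu1 nu -> (int_circle f nu <= int_circle f mu0)%E].
Proof.
move=> uf lam0 cx inj_x r0 mu1E.
have [t [w [a [fea tmax]]]] := feasible_maximum lam uf cx r0.
have [mu0 [mu0ball mu0E]] := plan_of_feasible lam0 cx r0 fea mu1E.
have [ct a0 aw _] := fea.
have w0 k : 0 <= w k by apply: le_trans (aw k); exact: sumr_ge0.
exists mu0; split => //; first by exists (N + 2)%N, t, w; split.
move=> nu nuball.
have -> : int_circle f mu0 = (\sum_k w k * f (t k))%:E.
  by apply: integral_dirac_sum => //; [exact: measurable_circle|exact: measurable_usc].
(* Comparison with real lower bounds [s] also excludes the value +oo, and -oo is trivial. *)
have le_max (s : R) : (s%:E <= int_circle f nu)%E -> s <= \sum_k w k * f (t k).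
  move=> sle; apply: tmax => e e0.
  exact: (feasible_of_ball uf lam0 cx inj_x r0 mu1E nuball e0 sle).
move: le_max; case: (int_circle f nu) => [s|H|_]; last exact: leNye.
- by rewrite lee_fin; apply.
- by have := H (\sum_k w k * f (t k) + 1) (leey _); rewrite gerDl lt_geF.
Qed.
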